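(* Let $m,n\ge0$ be integers. On $\mathbb H\setminus\mathbb R$, $$H^Q_{m,n}(q,\overline q)=\left(-\overline{\partial}_s+q\right)^m(\overline q^{\,n})=\left(-\partial_s+\overline q\right)^n(q^m),$$ where $q$ and $\overline q$ inside the operators denote left multiplication by $q$ and by $\overline q$, respectively.
   Context: $\mathbb H$ is the algebra of real quaternions, $\mathbb S=\{I\in\mathbb H: I^2=-1\}$, $\overline q$ is the quaternionic conjugate. Every $q\in\mathbb H\setminus\mathbb R$ is written uniquely as $q=x+yI_q$ with $x\in\mathbb R$, $y>0$, $I_q\in\mathbb S$. For a real differentiable $f$, the left slice derivatives at $q\in\mathbb H\setminus\mathbb R$ are $$\partial_s f(q)=\tfrac12\left(\frac{\partial f_{I_q}}{\partial x}-I_q\frac{\partial f_{I_q}}{\partial y}\right)(q),\qquad \overline{\partial}_s f(q)=\tfrac12\left(\frac{\partial f_{I_q}}{\partial x}+I_q\frac{\partial f_{I_q}}{\partial y}\right)(q),$$ where $f_I$ is the restriction of $f$ to the slice $L_I=\mathbb R+\mathbb R I$, with coordinates $(x,y)\mapsto x+yI$. For integers $m,n\ge0$, $$H^Q_{m,n}(q,\overline q)=\sum_{k=0}^{\min(m,n)}(-1)^k k!\binom mk\binom nk q^{m-k}\overline q^{\,n-k}.$$ *)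

(* Defs.v *)
From HB Require Import structures.
From mathcomp Require Import all_boot all_order all_algebra.
From mathcomp Require Import ring lra.
From mathcomp Require Import all_classical all_reals all_analysis.

Set Implicit Arguments.
Unset Strict Implicit.
Unset Printing Implicit Defensive.

Import Order.TTheory GRing.Theory Num.Theory.
Import numFieldNormedType.Exports.

Local Open Scope classical_set_scope.
Local Open Scope ring_scope.

(* The quaternion a + b i + c j + d k is the row vector (a, b, c, d), so the
   linear and topological structures are those of R^4.  The library norm on
   row vectors is the sup norm; being equivalent to the Euclidean norm, it
   gives the same limits, derivatives and differentiable functions. *)
Definition quat (R : realType) : Type := 'rV[R]_4.

HB.instance Definition _ (R : realType) :=
  NormedModule.copy (quat R) 'rV[R]_4.

Section Quaternions.
Variable R : realType.
Implicit Types p q : quat R.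

Definition mkquat (a b c d : R) : quat R := \row_(j < 4) [:: a; b; c; d]`_j.

Definition qre q : R := q 0 (inord 0).
Definition qi q : R := q 0 (inord 1).
Definition qj q : R := q 0 (inord 2).
Definition qk q : R := q 0 (inord 3).

Definition mulq p q : quat R := mkquat
  (qre p * qre q - qi p * qi q - qj p * qj q - qk p * qk q)
  (qre p * qi q + qi p * qre q + qj p * qk q - qk p * qj q)
  (qre p * qj q - qi p * qk q + qj p * qre q + qk p * qi q)
  (qre p * qk q + qi p * qj q - qj p * qi q + qk p * qre q).

Definition oneq : quat R := mkquat 1 0 0 0.

Lemma quatP p q : qre p = qre q -> qi p = qi q -> qj p = qj q -> qk p = qk q ->
  p = q.
Proof.
rewrite /qre /qi /qj /qk => h0 h1 h2 h3; apply/rowP => -[[|[|[|[|//]]]] lti].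
- by have -> : Ordinal lti = inord 0 by apply/val_inj; rewrite /= inordK.
- by have -> : Ordinal lti = inord 1 by apply/val_inj; rewrite /= inordK.
- by have -> : Ordinal lti = inord 2 by apply/val_inj; rewrite /= inordK.
- by have -> : Ordinal lti = inord 3 by apply/val_inj; rewrite /= inordK.
Qed.

Lemma qre_mk a b c d : qre (mkquat a b c d) = a.
Proof. by rewrite /qre mxE inordK. Qed.
Lemma qi_mk a b c d : qi (mkquat a b c d) = b.
Proof. by rewrite /qi mxE inordK. Qed.
Lemma qj_mk a b c d : qj (mkquat a b c d) = c.
Proof. by rewrite /qj mxE inordK. Qed.
Lemma qk_mk a b c d : qk (mkquat a b c d) = d.
Proof. by rewrite /qk mxE inordK. Qed.

Lemma qreD p q : qre (p + q) = qre p + qre q. Proof. exact: mxE. Qed.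
Lemma qiD p q : qi (p + q) = qi p + qi q. Proof. exact: mxE. Qed.
Lemma qjD p q : qj (p + q) = qj p + qj q. Proof. exact: mxE. Qed.
Lemma qkD p q : qk (p + q) = qk p + qk q. Proof. exact: mxE. Qed.
Lemma qreN p : qre (- p) = - qre p. Proof. exact: mxE. Qed.
Lemma qiN p : qi (- p) = - qi p. Proof. exact: mxE. Qed.
Lemma qjN p : qj (- p) = - qj p. Proof. exact: mxE. Qed.
Lemma qkN p : qk (- p) = - qk p. Proof. exact: mxE. Qed.
Lemma qreZ (a : R) p : qre (a *: p) = a * qre p. Proof. exact: mxE. Qed.
Lemma qiZ (a : R) p : qi (a *: p) = a * qi p. Proof. exact: mxE. Qed.
Lemma qjZ (a : R) p : qj (a *: p) = a * qj p. Proof. exact: mxE. Qed.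
Lemma qkZ (a : R) p : qk (a *: p) = a * qk p. Proof. exact: mxE. Qed.

Definition quatE :=
  (qre_mk, qi_mk, qj_mk, qk_mk, qreD, qiD, qjD, qkD, qreN, qiN, qjN, qkN,
   qreZ, qiZ, qjZ, qkZ).

Lemma mulqA : associative mulq.
Proof. by move=> p q r; apply: quatP; rewrite /mulq !quatE; ring. Qed.
Lemma mul1q : left_id oneq mulq.
Proof. by move=> p; apply: quatP; rewrite /mulq /oneq !quatE; ring. Qed.
Lemma mulq1 : right_id oneq mulq.
Proof. by move=> p; apply: quatP; rewrite /mulq /oneq !quatE; ring. Qed.
Lemma mulqDl : left_distributive mulq +%R.
Proof. by move=> p q r; apply: quatP; rewrite /mulq !quatE; ring. Qed.
Lemma mulqDr : right_distributive mulq +%R.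
Proof. by move=> p q r; apply: quatP; rewrite /mulq !quatE; ring. Qed.
Lemma oneq_neq0 : oneq != 0.
Proof.
apply/eqP => /(congr1 qre); rewrite quatE /qre mxE => /eqP.
by rewrite oner_eq0.
Qed.

HB.instance Definition _ := GRing.Zmodule_isNzRing.Build (quat R)
  mulqA mul1q mulq1 mulqDl mulqDr oneq_neq0.

Lemma scaleqAl (a : R) p q : a *: (p * q) = (a *: p) * q.
Proof. by apply: quatP; rewrite /GRing.mul /= /mulq !quatE; ring. Qed.
Lemma scaleqAr (a : R) p q : a *: (p * q) = p * (a *: q).
Proof. by apply: quatP; rewrite /GRing.mul /= /mulq !quatE; ring. Qed.

HB.instance Definition _ := GRing.Lmodule_isLalgebra.Build R (quat R) scaleqAl.
HB.instance Definition _ := GRing.Lalgebra_isAlgebra.Build R (quat R) scaleqAr.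

Definition conjq q : quat R := mkquat (qre q) (- qi q) (- qj q) (- qk q).

Definition nonreal : set (quat R) := ~` range (fun x : R => x%:A).

Definition imag_units : set (quat R) := [set I | I ^+ 2 = -1].

(* For nonreal q, the x, y and I_q of the decomposition q = x + y I_q are
   qre q, qy q and qI q; see slice_decomp and slice_decomp_uniq. *)
Definition qy q : R := Num.sqrt (qi q ^+ 2 + qj q ^+ 2 + qk q ^+ 2).
Definition qI q : quat R := (qy q)^-1 *: mkquat 0 (qi q) (qj q) (qk q).

Lemma qre1 : qre 1 = 1. Proof. exact: qre_mk. Qed.
Lemma qi1 : qi 1 = 0. Proof. exact: qi_mk. Qed.
Lemma qj1 : qj 1 = 0. Proof. exact: qj_mk. Qed.
Lemma qk1 : qk 1 = 0. Proof. exact: qk_mk. Qed.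
Definition quat1E := (qre1, qi1, qj1, qk1).

Lemma mulqE p q : p * q = mulq p q. Proof. by []. Qed.

Lemma imag_unitsP I : imag_units I <->
  qre I = 0 /\ qi I ^+ 2 + qj I ^+ 2 + qk I ^+ 2 = 1.
Proof.
rewrite /imag_units /= expr2 mulqE; split => [h|[h0 h1]].
- have := congr1 qk h; have := congr1 qj h.
  have := congr1 qi h; have := congr1 qre h.
  rewrite /mulq !quatE ?quat1E => e0 e1 e2 e3.
  have re0 : qre I = 0.
    have [//|nz] := eqVneq (qre I) 0.
    have z1 : qi I = 0 by apply: (mulfI nz); lra.
    have z2 : qj I = 0 by apply: (mulfI nz); lra.
    have z3 : qk I = 0 by apply: (mulfI nz); lra.
    have := sqr_ge0 (qre I).
    by move: e0; rewrite z1 z2 z3 expr2; lra.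
  by split=> //; move: e0; rewrite re0 !expr2; lra.
- by apply: quatP; rewrite /mulq !quatE ?quat1E h0 -?h1; ring.
Qed.

Lemma qy_gt0 q : nonreal q -> 0 < qy q.
Proof.
move=> nr; rewrite lt_neqAle sqrtr_ge0 andbT eq_sym sqrtr_eq0 -ltNge.
rewrite lt_neqAle !addr_ge0 ?sqr_ge0// andbT eq_sym.
apply/negP; rewrite paddr_eq0 ?addr_ge0 ?sqr_ge0// paddr_eq0 ?sqr_ge0//.
rewrite !sqrf_eq0 => /andP[/andP[/eqP h1 /eqP h2] /eqP h3]; apply: nr.
exists (qre q) => //; apply: quatP; rewrite !quatE ?quat1E ?h1 ?h2 ?h3; ring.
Qed.

Lemma slice_decomp q : nonreal q ->
  [/\ 0 < qy q, imag_units (qI q) & q = (qre q)%:A + qy q *: qI q].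
Proof.
move=> nr; have y0 := qy_gt0 nr; have yn : qy q != 0 by rewrite gt_eqF.
split=> //.
- apply/imag_unitsP; rewrite /qI !quatE mulr0; split=> //.
  have e : qy q ^+ 2 = qi q ^+ 2 + qj q ^+ 2 + qk q ^+ 2.
    by rewrite sqr_sqrtr// !addr_ge0 ?sqr_ge0.
  by rewrite !exprMn -!mulrDr -e exprVn mulVf// expf_neq0.
- rewrite /qI scalerA divff// scale1r.
  by apply: quatP; rewrite !quatE ?quat1E; ring.
Qed.

Lemma slice_decomp_uniq q (x y : R) (I : quat R) : 0 < y -> imag_units I ->
  q = x%:A + y *: I -> [/\ x = qre q, y = qy q & I = qI q].
Proof.
move=> y0 /imag_unitsP[re0 nI] ->.
have yn : y != 0 by rewrite gt_eqF.
have yE : qy (x%:A + y *: I) = y.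
  rewrite /qy !quatE ?quat1E !mulr0 !add0r !exprMn -!mulrDr nI mulr1.
  by rewrite sqrtr_sqr gtr0_norm.
split; rewrite /qI ?yE ?quatE ?quat1E ?re0 //; first by ring.
by apply: quatP; rewrite !quatE ?quat1E ?re0; field.
Qed.

Definition slice (f : quat R -> quat R) (I : quat R) (x y : R) : quat R :=
  f (x%:A + y *: I).

Definition slice_dx f q : quat R :=
  derive1 (fun t : R => slice f (qI q) t (qy q)) (qre q).
Definition slice_dy f q : quat R :=
  derive1 (fun t : R => slice f (qI q) (qre q) t) (qy q).

(* As the library's derivative is total, these are meaningful only where f is
   real differentiable and q is not real. *)
Definition ds f q : quat R := 2^-1 *: (slice_dx f q - qI q * slice_dy f q).
Definition dsbar f q : quat R := 2^-1 *: (slice_dx f q + qI q * slice_dy f q).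

Definition op_dsbar (f : quat R -> quat R) : quat R -> quat R :=
  fun q => - dsbar f q + q * f q.
Definition op_ds (f : quat R -> quat R) : quat R -> quat R :=
  fun q => - ds f q + conjq q * f q.

(* H^Q_{m,n} as a function of two quaternion arguments, used at (q, conjq q). *)
Definition hermiteQ (m n : nat) (q p : quat R) : quat R :=
  \sum_(k < (minn m n).+1)
    ((-1) ^+ k * (k`! * 'C(m, k) * 'C(n, k))%:R) * q ^+ (m - k) * p ^+ (n - k).

(* The operator power op^k f is defined when op is only ever applied to
   functions that are real differentiable off the real axis. *)
Definition pow_defined (op : (quat R -> quat R) -> (quat R -> quat R))
    (k : nat) (f : quat R -> quat R) : Prop :=
  forall j, (j < k)%N -> forall q, nonreal q -> differentiable (iter j op f) q.

End Quaternions.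

(* Main.v *)
From HB Require Import structures.
Require Import Defs.
From mathcomp Require Import all_boot all_order all_algebra.
From mathcomp Require Import ring.
From mathcomp Require Import all_classical all_reals all_analysis.
Import Order.TTheory GRing.Theory Num.Theory.
Import numFieldNormedType.Exports.
Local Open Scope ring_scope.

(** Write H m n for the function q |-> hermiteQ m n q (conjq q) and D for the
    operator dsbar.  The proof is the ladder argument known from the complex
    Ito-Hermite polynomials, and it survives the lack of commutativity because
    only one imaginary unit, I = qI q, is involved at each point q, and it
    commutes with q and with conjq q.

    Three rules for D hold at every nonreal q: D is real linear; it commutes
    with left multiplication by q, i.e. D (q f) = q D f, as the term
    (f + I I f) / 2 coming from the derivative of q vanishes (has_dsbar_mull);
    and D (conjq f) = f + conjq D f (has_dsbar_conjq_mull).  The last one gives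
    D (conjq ^+ n) = n conjq ^+ n.-1.  On the other side, Pascal's rule for the
    coefficients gives the recurrence H m.+1 n = q H m n - n H m n.-1
    (hermiteQSm), in which q stays on the left.  Induction on m along this
    recurrence yields the lowering rule D (H m n) = n H m n.-1
    (has_dsbar_hermiteQ), so that the recurrence reads
    H m.+1 n = (- D + q) (H m n).  Iterating from H 0 n = conjq ^+ n proves the
    first equality, as D is local and the nonreal quaternions form an open set.

    The second equality is the mirror image of the first one.  Composition with
    conjugation maps I to - I, hence it exchanges op_ds and op_dsbar
    (op_ds_comp_conjq).  The iterates of op_ds starting from q ^+ m are
    therefore those of op_dsbar starting from conjq ^+ m, evaluated at conjq q,
    and the coefficients of hermiteQ are symmetric in m and n. *)

Section QuaternionicHermite.
Local Open Scope classical_set_scope.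
Set Implicit Arguments.
Unset Strict Implicit.
Context {R : realType}.
Implicit Types (f g : quat R -> quat R) (p q v : quat R) (a : R).

(** * Differential calculus on the quaternions *)

Lemma mkquat_continuous (T : topologicalType) (a b c d : T -> R) (x : T) :
  {for x, continuous a} -> {for x, continuous b} ->
  {for x, continuous c} -> {for x, continuous d} ->
  {for x, continuous (fun y => mkquat (a y) (b y) (c y) (d y))}.
Proof.
move=> ca cb cc cd.
have -> : (fun y => mkquat (a y) (b y) (c y) (d y)) =
    (fun y => a y *: mkquat 1 0 0 0 + b y *: mkquat 0 1 0 0 +
              c y *: mkquat 0 0 1 0 + d y *: mkquat 0 0 0 1).
  by apply/funext => y; apply: quatP; rewrite !quatE; ring.
by do !apply: continuousD; apply: continuousZr_tmp.
Qed.

Lemma coordq_continuous :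
  [/\ continuous (@qre R), continuous (@qi R),
      continuous (@qj R) & continuous (@qk R)].
Proof. by split; apply: coord_continuous. Qed.

Lemma mulq_continuous :
  continuous (fun p : quat R * quat R => Defs.mulq p.1 p.2).
Proof.
have [cre ci cj ck] := coordq_continuous.
move=> p.
have fst_snd (c : quat R -> R) : continuous c ->
    {for p, continuous (fun z => c z.1)} /\
    {for p, continuous (fun z => c z.2)}.
  by move=> cc; split; apply: continuous_comp; [exact: cvg_fst|exact: cc|
    exact: cvg_snd|exact: cc].
have [? ?] := fst_snd _ cre; have [? ?] := fst_snd _ ci.
have [? ?] := fst_snd _ cj; have [? ?] := fst_snd _ ck.
rewrite /Defs.mulq; apply: (@mkquat_continuous _ _ _ _ _ p);
  by do ?[apply: continuousB|apply: continuousD]; apply: continuousM.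
Qed.

(** The Leibniz rule is read off from the differential of a continuous bilinear
    map, which asks for a bilinear structure on the product. *)
Lemma mulq_is_bilinear :
  bilinear_for
    (GRing.Scale.Law.clone _ _ *:%R _) (GRing.Scale.Law.clone _ _ *:%R _)
    (@Defs.mulq R).
Proof.
split=> [p|p] a x y /=.
- by rewrite -!mulqE mulrDl scalerAl.
- by rewrite -!mulqE mulrDr scalerAr.
Qed.
HB.instance Definition _ :=
  bilinear_isBilinear.Build R (quat R) (quat R) (quat R) _ _ (@Defs.mulq R)
    mulq_is_bilinear.

Lemma is_diffM q f g (df dg : quat R -> quat R) :
  is_diff q f df -> is_diff q g dg ->
  is_diff q (fun p => f p * g p) (fun v => f q * dg v + df v * g q).
Proof.
move=> dfq dgq.
have dM : is_diff (f q, g q) (fun z : quat R * quat R => Defs.mulq z.1 z.2)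
    (fun z => f q * z.2 + z.1 * g q).
  apply: DiffDef; first exact: differentiable_bilin mulq_continuous.
  by rewrite diff_bilin //; exact: mulq_continuous.
exact: (@is_diff_comp _ _ _ _ (fun p => (f p, g p)) (fun v => (df v, dg v))).
Qed.

Lemma is_diff_conjq q : is_diff q (@conjq R) (@conjq R).
Proof.
have lin : linear (@conjq R).
  by move=> a u v; apply: quatP; rewrite !quatE; ring.
pose L : {linear quat R -> quat R} :=
  HB.pack (@conjq R) (GRing.isLinear.Build _ _ _ _ _ lin).
have [cre ci cj ck] := coordq_continuous.
have cL : continuous L.
  by move=> p; apply: mkquat_continuous; do ?apply: continuousN;
    [exact: cre|exact: ci|exact: cj|exact: ck].
by apply: DiffDef;
  [exact: (@linear_differentiable _ _ _ L)|exact: (@diff_lin _ _ _ L)].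
Qed.

(** Differentials are germs at q; this transports the computation for the
    Hermite polynomials to the iterates of the operators, which agree with them
    only off the real axis. *)
Lemma is_diff_near f g (df : quat R -> quat R) q :
  {near q, f =1 g} -> is_diff q f df -> is_diff q g df.
Proof.
move=> fg dfq.
have gE : g \o shift q = cst (g q) + 'd f q +o_ (0 : quat R) id.
  apply/eqaddoP => e e0.
  have := diff_locally (@ex_diff _ _ _ _ _ _ _ dfq).
  move/eqaddoP => /(_ e e0).
  apply: filter_app.
  have : \forall h \near (0 : quat R), f (h + q) = g (h + q).
    by move: fg; rewrite (near_shift 0) subr0.
  apply: filter_app; near=> h => fgh; rewrite /= !fctE /= fgh.
  by rewrite (nbhs_singleton fg).
have gd : 'd g q = 'd f q :> (quat R -> quat R).
  by apply: diff_unique => //; apply: diff_continuous.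
apply: DiffDef; last by rewrite gd diff_val.
by apply/diff_locallyP; rewrite gd; split => //; apply: diff_continuous.
Unshelve. all: by end_near. Qed.

Lemma nonreal_open : open (@nonreal R).
Proof.
have [_ ci cj ck] := coordq_continuous.
have -> : @nonreal R =
    (fun q => qi q ^+ 2 + qj q ^+ 2 + qk q ^+ 2) @^-1` [set x : R | 0 < x].
  apply/seteqP; split=> q /=.
    by move=> /qy_gt0; rewrite /qy sqrtr_gt0.
  move=> n0 [x _ qx]; move: n0.
  by rewrite -qx !quatE ?quat1E !mulr0 expr0n /= !addr0 ltxx.
apply: open_comp; last exact: open_gt.
have sq (c : quat R -> R) : continuous c -> continuous (fun q => c q ^+ 2).
  by move=> cc q; have := continuousM (cc q) (cc q).
move=> q _.
exact: continuousD (continuousD (sq _ ci q) (sq _ cj q)) (sq _ ck q).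
Qed.

(** * Calculus rules for the slice derivative *)

(** As q = x + y I, moving x or y with I fixed is moving q along 1 or I, so the
    slice derivatives are directional derivatives. *)
Lemma slice_dxE f q : nonreal q -> slice_dx f q = 'D_1 f q.
Proof.
move=> /slice_decomp[_ _ qE].
rewrite /slice_dx /derive1 /derive /slice; set F := (fun h : R => _).
set G := (fun h : R => _); suff -> : F = G by [].
by apply/funext => h; rewrite /F /G /= scalerDl -addrA -qE.
Qed.

Lemma slice_dyE f q : nonreal q -> slice_dy f q = 'D_(qI q) f q.
Proof.
move=> /slice_decomp[_ _ qE].
rewrite /slice_dy /derive1 /derive /slice; set F := (fun h : R => _).
set G := (fun h : R => _); suff -> : F = G by [].
by apply/funext => h; rewrite /F /G /= scalerDl addrCA -qE.
Qed.

Lemma dsbarE f (df : quat R -> quat R) q : nonreal q -> is_diff q f df ->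
  dsbar f q = 2^-1 *: (df 1 + qI q * df (qI q)).
Proof.
move=> nr dfq; have dif := @ex_diff _ _ _ _ _ _ _ dfq.
by rewrite /dsbar slice_dxE// slice_dyE// !deriveE// diff_val.
Qed.

Lemma qI_sqr q : nonreal q -> qI q * qI q = -1.
Proof. by move=> /slice_decomp[_ + _]; rewrite /imag_units /= expr2. Qed.

Lemma qI_comm q : qI q * q = q * qI q.
Proof. by apply: quatP; rewrite !quatE; ring. Qed.

Lemma qI_conjq q : conjq (qI q) = - qI q.
Proof. by apply: quatP; rewrite /qI !quatE; ring. Qed.

Lemma conjq1 : conjq 1 = 1 :> quat R.
Proof. by apply: quatP; rewrite !quatE ?quat1E; ring. Qed.

Lemma conjqK : involutive (@conjq R).
Proof. by move=> q; apply: quatP; rewrite !quatE ?opprK. Qed.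

Lemma conjqM p q : conjq (p * q) = conjq q * conjq p.
Proof. by apply: quatP; rewrite !mulqE /Defs.mulq !quatE; ring. Qed.

(** The value of dsbar is meaningful only together with differentiability, and
    the rules below propagate both at once. *)
Definition has_dsbar f q v : Prop := differentiable f q /\ dsbar f q = v.

Lemma has_dsbar_near f g q v :
  {near q, f =1 g} -> nonreal q -> has_dsbar f q v -> has_dsbar g q v.
Proof.
move=> fg nr [/differentiableP dfq <-].
have dgq := is_diff_near fg dfq.
by split; [exact: ex_diff|rewrite (dsbarE nr dfq) (dsbarE nr dgq)].
Qed.

Lemma has_dsbar_cst (c : quat R) q : nonreal q -> has_dsbar (fun=> c) q 0.
Proof.
move=> nr; have dc := is_diff_cst c q.
split; first exact: ex_diff.
by rewrite (dsbarE nr dc) mulr0 addr0 scaler0.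
Qed.

Lemma has_dsbarD f g q v w : nonreal q -> has_dsbar f q v -> has_dsbar g q w ->
  has_dsbar (fun p => f p + g p) q (v + w).
Proof.
move=> nr [/differentiableP df <-] [/differentiableP dg <-].
have dfg := is_diffD df dg.
split; first exact: ex_diff.
rewrite (dsbarE nr df) (dsbarE nr dg) (dsbarE nr dfg).
by rewrite -scalerDr !fctE mulrDr addrACA.
Qed.

Lemma has_dsbarZ a f q v : nonreal q -> has_dsbar f q v ->
  has_dsbar (fun p => a *: f p) q (a *: v).
Proof.
move=> nr [/differentiableP df <-].
have dfa := is_diffZ a df.
split; first exact: ex_diff.
rewrite (dsbarE nr df) (dsbarE nr dfa) !fctE.
by rewrite -scalerAr -scalerDr !scalerA mulrC.
Qed.

(** The slice derivative of q itself is (1 + I * I) / 2 = 0, and I commutes with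
    q; so q behaves as a constant on the left. *)
Lemma has_dsbar_mull f q v : nonreal q -> has_dsbar f q v ->
  has_dsbar (fun p => p * f p) q (q * v).
Proof.
move=> nr [/differentiableP df <-].
have dif := is_diffM (is_diff_id q) df.
split; first exact: ex_diff.
rewrite (dsbarE nr df) (dsbarE nr dif) -scalerAr; congr (_ *: _).
rewrite !mulrDr mul1r !mulrA qI_comm qI_sqr// mulN1r.
by rewrite addrACA subrr addr0.
Qed.

(** Here conjugation contributes (1 + I * (- I)) / 2 = 1. *)
Lemma has_dsbar_conjq_mull f q v : nonreal q -> has_dsbar f q v ->
  has_dsbar (fun p => conjq p * f p) q (f q + conjq q * v).
Proof.
move=> nr [/differentiableP df <-].
have dif := is_diffM (is_diff_conjq q) df.
have comm : qI q * conjq q = conjq q * qI q.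
  apply: (can_inj conjqK).
  by rewrite !conjqM conjqK qI_conjq mulrN mulNr qI_comm.
split; first exact: ex_diff.
rewrite (dsbarE nr df) (dsbarE nr dif) -scalerAr conjq1 qI_conjq.
rewrite !mulrDr mul1r !mulrA comm mulrN qI_sqr// opprK mul1r addrACA.
rewrite scalerDr [RHS]addrC; congr (_ + _).
by rewrite -mulr2n -(scaler_nat 2 (f q)) scalerA mulVf ?pnatr_eq0// scale1r.
Qed.

Lemma has_dsbar_conjqX n q : nonreal q ->
  has_dsbar (fun p => conjq p ^+ n) q (n%:R * conjq q ^+ n.-1).
Proof.
move=> nr; elim: n => [|n IH].
  by rewrite mul0r; exact: has_dsbar_cst.
have -> : n.+1%:R * conjq q ^+ n.+1.-1 =
    conjq q ^+ n + conjq q * (n%:R * conjq q ^+ n.-1).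
  rewrite -natr1 mulrDl mul1r addrC; congr (_ + _).
  case: n {IH} => [|n]; first by rewrite !mul0r mulr0.
  by rewrite exprS !mulrA commr_nat.
by rewrite (_ : (fun p => _) = fun p => conjq p * conjq p ^+ n);
  [exact: has_dsbar_conjq_mull|apply/funext => p; rewrite exprS].
Qed.

(** * Recurrence and lowering rule for the Hermite polynomials *)

Lemma hermiteQ0m n q p : hermiteQ 0 n q p = p ^+ n.
Proof. by rewrite /hermiteQ min0n big_ord1 expr0 !bin0 !mul1r subn0. Qed.

(** The terms beyond minn m n vanish with their binomials.  A free number of
    terms lets the three sums of the recurrence be compared term by term. *)
Lemma hermiteQ_extend (N m n : nat) q p : (minn m n < N)%N ->
  hermiteQ m n q p = \sum_(k < N)
    ((-1) ^+ k * (k`! * 'C(m, k) * 'C(n, k))%:R) * q ^+ (m - k) * p ^+ (n - k).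
Proof.
move=> ltN; rewrite /hermiteQ (big_ord_widen _ (fun k => ((-1) ^+ k *
  (k`! * 'C(m, k) * 'C(n, k))%:R) * q ^+ (m - k) * p ^+ (n - k)) ltN).
rewrite [RHS](bigID (fun k : 'I_N => (k < (minn m n).+1)%N)) /=.
rewrite [X in _ = _ + X]big1 ?addr0// => k.
rewrite ltnS leq_min negb_and -!ltnNge.
by case/orP => lt_k; rewrite (bin_small lt_k) ?muln0 // mulr0 !mul0r.
Qed.

(** With c m n k = k! 'C(m, k) 'C(n, k), Pascal's rule and the absorption
    identity (k + 1) 'C(n, k + 1) = n 'C(n - 1, k) give
    c m.+1 n k.+1 = c m n k.+1 + n (c m n.-1 k).  Multiplying by q on the
    left acts on the powers of q alone and never moves q past p. *)
Lemma hermiteQSm m n q p : hermiteQ m.+1 n q p =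
  q * hermiteQ m n q p - n%:R * hermiteQ m n.-1 q p.
Proof.
rewrite (@hermiteQ_extend m.+2); last by rewrite ltnS geq_minl.
rewrite (@hermiteQ_extend m.+2 m n); last first.
  by rewrite ltnS (leq_trans (geq_minl _ _)).
rewrite (@hermiteQ_extend m.+1 m n.-1); last by rewrite ltnS geq_minl.
rewrite big_ord_recl [in RHS]big_ord_recl /= !bin0 mulrDr -addrA; congr (_ + _).
  by rewrite expr0 !mul1r !subn0 mulrA exprS.
rewrite !mulr_sumr -sumrB; apply: eq_bigr => k _.
rewrite /= /bump /= !add1n !subSS exprS mulN1r.
have -> : (n - k.+1 = n.-1 - k)%N by case: (n).
have -> : (k.+1`! * 'C(m.+1, k.+1) * 'C(n, k.+1) =
    k.+1`! * 'C(m, k.+1) * 'C(n, k.+1) + n * (k`! * 'C(m, k) * 'C(n.-1, k)))%N.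
  rewrite binS mulnDr mulnDl; congr addn.
  by rewrite [RHS]mulnCA mul_bin_diag factS [RHS]mulnCA !mulnA.
rewrite natrD mulrDr !mulrDl; congr (_ + _).
(* For k = m the exponent m - k.+1 is truncated to 0, and the first summand
   vanishes on both sides because of the binomial. *)
- have [lt_km|le_mk] := ltnP k m; last first.
    by rewrite bin_small// muln0 mul0n !mulr0 !mul0r mulr0.
  have qS j : q * (- (-1) ^+ k * j%:R) = - (-1) ^+ k * j%:R * q.
    by apply/commrM; [apply/commrN/commr_sign|apply/commr_nat].
  by rewrite 2!(mulrA q) qS -(mulrA _ q) -exprS subnSK.
- by rewrite natrM !mulNr !mulrA commr_sign.
Qed.

(** Lowering rule.  In the induction step both sides obey the recurrence
    hermiteQSm, since dsbar commutes with left multiplication by q. *)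
Lemma has_dsbar_hermiteQ m n q : nonreal q ->
  has_dsbar (fun p => hermiteQ m n p (conjq p)) q
    (n%:R * hermiteQ m n.-1 q (conjq q)).
Proof.
move=> nr; elim: m n => [|m IH] n.
  rewrite hermiteQ0m (_ : (fun p => _) = fun p => conjq p ^+ n).
    exact: has_dsbar_conjqX.
  by apply/funext => p; rewrite hermiteQ0m.
have natZ (k : nat) p : - (k%:R * p) = (- k%:R : R) *: p.
  by rewrite scaleNr scaler_nat mulr_natl.
rewrite (_ : (fun p => _) = fun p => p * hermiteQ m n p (conjq p) +
    (- n%:R : R) *: hermiteQ m n.-1 p (conjq p)); last first.
  by apply/funext => p; rewrite hermiteQSm natZ.
rewrite hermiteQSm mulrBr mulrA -(commr_nat q n) -mulrA natZ.
apply: has_dsbarD => //; first exact: has_dsbar_mull.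
exact: has_dsbarZ.
Qed.

(** * Iterates of the operators *)

Lemma iter_op_dsbarE m n q : nonreal q ->
  iter m (@op_dsbar R) (fun p => conjq p ^+ n) q = hermiteQ m n q (conjq q).
Proof.
elim: m q => [|m IH] q nr /=; first by rewrite hermiteQ0m.
rewrite /op_dsbar IH// hermiteQSm addrC; congr (_ - _).
apply: (proj2 (has_dsbar_near _ nr (has_dsbar_hermiteQ m n nr))).
by apply: filterS (open_nbhs_nbhs (conj nonreal_open nr)) => p nrp; rewrite IH.
Qed.

Lemma differentiable_iter_op_dsbar m n q : nonreal q ->
  differentiable (iter m (@op_dsbar R) (fun p => conjq p ^+ n)) q.
Proof.
move=> nr.
apply: (proj1 (has_dsbar_near _ nr (has_dsbar_hermiteQ m n nr))).
apply: filterS (open_nbhs_nbhs (conj nonreal_open nr)) => p nrp.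
by rewrite iter_op_dsbarE.
Qed.

(** The point x + y (- I) is the conjugate of x + y I. *)
Lemma slice_conjq f q x y :
  slice f (qI (conjq q)) x y = slice (f \o @conjq R) (qI q) x y.
Proof.
rewrite /slice /=; congr f.
by apply: quatP; rewrite /qI /qy !quatE ?quat1E !sqrrN; ring.
Qed.

(** Conjugation maps I to - I and keeps x and y, which turns the sign in ds into
    the one in dsbar.  At real points the sign is immaterial, as qI is 0 there. *)
Lemma op_ds_comp_conjq f : op_ds (f \o @conjq R) = op_dsbar f \o @conjq R.
Proof.
have sliceE q : slice f (qI (conjq q)) = slice (f \o @conjq R) (qI q).
  by apply/funext => x; apply/funext => y; exact: slice_conjq.
have qIN q : qI (conjq q) = - qI q.
  by apply: quatP; rewrite /qI /qy !quatE !sqrrN; ring.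
have qyE q : qy (conjq q) = qy q by rewrite /qy !quatE !sqrrN.
have qreE q : qre (conjq q) = qre q by rewrite quatE.
apply/funext => q; rewrite /op_ds /op_dsbar /ds /dsbar /=.
by rewrite /slice_dx /slice_dy sliceE qyE qreE qIN mulNr.
Qed.

Lemma iter_op_ds_conjq n m q :
  iter n (@op_ds R) (fun p => p ^+ m) q =
  iter n (@op_dsbar R) (fun p => conjq p ^+ m) (conjq q).
Proof.
suff -> : iter n (@op_ds R) (fun p => p ^+ m) =
   iter n (@op_dsbar R) (fun p => conjq p ^+ m) \o @conjq R by [].
elim: n => [|n IH] /=; first by apply/funext => p /=; rewrite conjqK.
by rewrite IH op_ds_comp_conjq.
Qed.

Lemma nonreal_conjq q : nonreal q -> nonreal (conjq q).
Proof.
move=> nr [x _ xq]; apply: nr; exists x => //.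
apply: (can_inj conjqK); rewrite -xq.
by apply: quatP; rewrite !quatE ?quat1E; ring.
Qed.

Lemma hermiteQC m n q p : GRing.comm q p -> hermiteQ m n q p = hermiteQ n m p q.
Proof.
move=> cqp; rewrite /hermiteQ minnC; apply: eq_bigr => k _.
rewrite mulnAC -!mulrA; congr (_ * (_ * _)).
by apply/commrX/commr_sym/commrX/commr_sym.
Qed.

Lemma conjq_comm q : GRing.comm q (conjq q).
Proof. by apply: quatP; rewrite !quatE; ring. Qed.

End QuaternionicHermite.

Theorem proposition3p4 (R : realType) (m n : nat) :
  [/\ pow_defined (@op_dsbar R) m (fun q => conjq q ^+ n),
      pow_defined (@op_ds R) n (fun q => q ^+ m)
    & forall q : quat R, nonreal q ->
        hermiteQ m n q (conjq q) = iter m (@op_dsbar R) (fun q => conjq q ^+ n) q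
        /\ iter m (@op_dsbar R) (fun q => conjq q ^+ n) q
           = iter n (@op_ds R) (fun q => q ^+ m) q].
Proof.
split=> [j _ q nr|j _ q nr|q nr].
- exact: differentiable_iter_op_dsbar.
- rewrite (_ : iter j _ _ =
      iter j (@op_dsbar R) (fun p => conjq p ^+ m) \o @conjq R); last first.
    by apply/funext => p; rewrite iter_op_ds_conjq.
  have dc := is_diff_conjq q.
  apply: differentiable_comp => //.
  exact/differentiable_iter_op_dsbar/nonreal_conjq.
- rewrite iter_op_ds_conjq !iter_op_dsbarE ?conjqK//; last exact: nonreal_conjq.
  by split=> //; apply/hermiteQC/conjq_comm.
Qed.
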